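(* $\#SM(1\text{-attribute})$ is solvable in polynomial time: there is a deterministic polynomial-time algorithm that, given a stable matching instance in the $1$-attribute model, outputs its number of stable matchings exactly.
   Context: A stable matching instance consists of $n$ men and $n$ women; each man has a strict total order (preference list) on all women and each woman a strict total order on all men. A matching (bijection between men and women) is stable if no man and woman not matched to each other both prefer each other to their assigned partners. In the $1$-attribute model each man $M$ has a real preference value $\hat M$ and a real position value $\bar M$, and similarly each woman; man $M$ prefers woman $w$ to $w'$ iff $\hat M\bar w > \hat M \bar w'$, and woman $w$ prefers man $M$ to $M'$ iff $\hat w \bar M > \hat w \bar M'$, where these products are pairwise distinct so that all preference lists are strict. $\#SM(1\text{-attribute})$ asks for the number of stable matchings of such an instance. *)

(* Defs.v *)
From mathcomp Require Import all_boot all_order all_algebra all_fingroup.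
From mathcomp Require Import reals.

Set Implicit Arguments.
Unset Strict Implicit.
Unset Printing Implicit Defensive.

Import GroupScope.
Local Open Scope nat_scope.

(** * Stable matchings *)

(* Men and women are both indexed by 'I_(sm_size I).  A strict total order on
   'I_n is given by its list from best to worst, as a permutation: [mlist m k]
   is the (k+1)-st choice of man m. *)
Record sm_instance := SMInstance {
  sm_size : nat;
  mlist : 'I_sm_size -> 'S_sm_size;
  wlist : 'I_sm_size -> 'S_sm_size }.

Definition mprefers (I : sm_instance) (m w w' : 'I_(sm_size I)) : bool :=
  (mlist m)^-1 w < (mlist m)^-1 w'.

Definition wprefers (I : sm_instance) (w m m' : 'I_(sm_size I)) : bool :=
  (wlist w)^-1 m < (wlist w)^-1 m'.

(* A matching is a permutation mu, man m being married to woman mu m. *)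
Definition blocking (I : sm_instance) (mu : 'S_(sm_size I))
    (m w : 'I_(sm_size I)) : bool :=
  [&& mu m != w, mprefers m w (mu m) & wprefers w m (mu^-1 w)].

Definition stable (I : sm_instance) (mu : 'S_(sm_size I)) : bool :=
  [forall m, forall w, ~~ blocking mu m w].

Definition num_stable (I : sm_instance) : nat :=
  #|[set mu : 'S_(sm_size I) | stable mu]|.

(* [mpre], [wpre] are the preference values (hat) and [mpos], [wpos] the
   position values (bar). *)
Definition one_attribute (R : realType) (I : sm_instance) : Prop :=
  exists mpre mpos wpre wpos : 'I_(sm_size I) -> R,
    [/\ forall m, injective (fun w => mpre m * wpos w)%R,
        forall w, injective (fun m => wpre w * mpos m)%R,
        forall m w w',
          mprefers m w w' <-> (mpre m * wpos w > mpre m * wpos w')%R &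
        forall w m m',
          wprefers w m m' <-> (wpre w * mpos m > wpre w * mpos m')%R].

(* The number n, then the n lists of the men, then the n lists of the women. *)
Definition encode_sm (I : sm_instance) : seq nat :=
  sm_size I ::
    [seq (mlist m k : nat) | m <- enum 'I_(sm_size I), k <- enum 'I_(sm_size I)]
    ++
    [seq (wlist w k : nat) | w <- enum 'I_(sm_size I), k <- enum 'I_(sm_size I)].

(** * Polynomial time *)

(* Random access machines with logarithmic cost (Cook and Reckhow): this is
   polynomially equivalent to deterministic Turing machines.  Registers
   X_0, X_1, ... hold natural numbers, and subtraction is truncated. *)
Inductive instr :=
  | IConst of nat & nat          (* X_i := c *)
  | IAdd of nat & nat & nat      (* X_i := X_j + X_k *)
  | ISub of nat & nat & nat      (* X_i := X_j - X_k *)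
  | ILoad of nat & nat           (* X_i := X_(X_j) *)
  | IStore of nat & nat          (* X_(X_i) := X_j *)
  | IJump of nat & nat.          (* if X_j > 0 then go to instruction p *)

Definition program := seq instr.

Record config := Config { pc : nat; reg : nat -> nat }.

Definition upd (X : nat -> nat) (i v : nat) : nat -> nat :=
  fun j => if j == i then v else X j.

(* A machine halts when its program counter leaves the program; a halted
   machine stays in the same configuration, at no cost. *)
Definition halted (P : program) (s : config) : bool := size P <= pc s.

Definition exec (ins : instr) (s : config) : config :=
  let X := reg s in
  match ins with
  | IConst i c => Config (pc s).+1 (upd X i c)
  | IAdd i j k => Config (pc s).+1 (upd X i (X j + X k))
  | ISub i j k => Config (pc s).+1 (upd X i (X j - X k))
  | ILoad i j => Config (pc s).+1 (upd X i (X (X j)))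
  | IStore i j => Config (pc s).+1 (upd X (X i) (X j))
  | IJump j p => Config (if 0 < X j then p else (pc s).+1) X
  end.

Definition step (P : program) (s : config) : config :=
  if onth P (pc s) is Some ins then exec ins s else s.

(* The number of binary digits, with bitlen 0 = 1. *)
Definition bitlen (n : nat) : nat := (trunc_log 2 n).+1.

(* The total length of the addresses and operands accessed. *)
Definition exec_cost (ins : instr) (X : nat -> nat) : nat :=
  match ins with
  | IConst i c => bitlen i + bitlen c
  | IAdd i j k | ISub i j k =>
      bitlen i + bitlen j + bitlen k + bitlen (X j) + bitlen (X k)
  | ILoad i j => bitlen i + bitlen j + bitlen (X j) + bitlen (X (X j))
  | IStore i j => bitlen i + bitlen (X i) + bitlen j + bitlen (X j)
  | IJump j p => bitlen j + bitlen (X j) + bitlen p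
  end.

Definition step_cost (P : program) (s : config) : nat :=
  if onth P (pc s) is Some ins then exec_cost ins (reg s) else 0.

(* The input x_1, ..., x_L is stored in X_1, ..., X_L, and L in X_0; all other
   registers are 0. *)
Definition initial (input : seq nat) : config :=
  Config 0 (nth 0 (size input :: input)).

Definition input_length (input : seq nat) : nat :=
  \sum_(x <- input) bitlen x.

(* On [input], P halts within time T with [output] in X_0. *)
Definition computes_within (P : program) (input : seq nat) (output T : nat) :
    Prop :=
  exists t : nat,
    let run i := iter i (step P) (initial input) in
    [/\ halted P (run t),
        reg (run t) 0 = output &
        \sum_(i < t) step_cost P (run i) <= T].

(* The function f, on the instances satisfying the promise D, is computed in
   time polynomial in the length of the encoding of the instance. *)
Definition polytime_on (T : Type) (encode : T -> seq nat) (D : T -> Prop)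
    (f : T -> nat) : Prop :=
  exists (P : program) (c d : nat), forall x : T, D x ->
    computes_within P (encode x) (f x) (c * input_length (encode x) ^ d + c).

(* Main.v *)
Require Import Defs.
From mathcomp Require Import all_boot all_order all_algebra all_fingroup.
From mathcomp Require Import reals.
From mathcomp Require Import zify.

(* Rank the men by the list of the first woman and the women by the list of the
   first man.  Every man then prefers either low or high ranks, and so does
   every woman; call this the type of the person.

   A stable matching is determined by its pattern, which records for each woman
   the type of her partner: a couple (i, j) must have as many men of the type of
   i that j prefers to i as there are women that i prefers to j, with the type
   of j and with a partner of the type of i.  If a woman whose partner prefers
   high ranks stands above a woman whose partner prefers low ranks, these two
   partners envy each other, so the two women have opposite types.  Hence, if p
   is the first woman with a partner of the former kind and q the last with one
   of the latter kind, either q < p and the pattern is determined by the number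
   of men of each type, or p < q and between p and q the pattern can be read off
   the types of the women.  This leaves at most 1 + n^2 patterns, each of which
   is tested separately.

   The whole count is thus an expression built from the input with +, truncated
   -, and sums over i < n.  Such expressions are compiled to machine code whose
   running time is a polynomial in n. *)

Set Implicit Arguments.
Unset Strict Implicit.
Unset Printing Implicit Defensive.

Import GroupScope Order.TTheory GRing.Theory Num.Theory.
Local Open Scope nat_scope.

(** * Runs of the machine *)

Definition code_at (P : program) (p : nat) (c : program) : Prop :=
  exists2 pre, size pre = p & exists post, P = pre ++ c ++ post.

Lemma code_at_cat P p c1 c2 : code_at P p (c1 ++ c2) ->
  code_at P p c1 /\ code_at P (p + size c1) c2.
Proof.
case=> pre sz [post ->]; split.
  by exists pre => //; exists (c2 ++ post); rewrite -!catA.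
by exists (pre ++ c1); [rewrite size_cat sz|exists post; rewrite -!catA].
Qed.

Lemma code_at_cons P p ins c : code_at P p (ins :: c) ->
  (forall X, step P (Config p X) = exec ins (Config p X)) /\
  code_at P p.+1 c.
Proof.
move=> cP; split; last by have [_] := @code_at_cat P p [:: ins] c cP; rewrite addn1.
case: cP => pre sz [post ->] X; rewrite /step /= onth_cat sz ltnn subnn.
by [].
Qed.

Definition reaches (P : program) (t : nat) (s s' : config) : Prop :=
  iter t (step P) s = s'.

Lemma reaches_trans P t1 t2 s1 s2 s3 :
  reaches P t1 s1 s2 -> reaches P t2 s2 s3 -> reaches P (t1 + t2) s1 s3.
Proof. by rewrite /reaches addnC iterD => -> ->. Qed.

Lemma reaches_step P t s1 s2 : reaches P t (step P s1) s2 -> reaches P t.+1 s1 s2.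
Proof. by rewrite /reaches iterSr. Qed.

Lemma updE X i v y : upd X i v y = if y == i then v else X y. Proof. by []. Qed.

(** * Bounded-sum expressions *)

(* Variables are registers: 0 points just before the copy of the input, 1 holds
   the constant 1 and 2 holds the bound of all sums. *)
Inductive expr :=
  | EVar of nat
  | ECst of nat
  | EAdd of expr & expr
  | ESub of expr & expr
  | EInp of expr
  | ESum of nat & expr.

Fixpoint eval (N : nat) (inp rho : nat -> nat) (e : expr) : nat :=
  match e with
  | EVar x => rho x
  | ECst c => c
  | EAdd a b => eval N inp rho a + eval N inp rho b
  | ESub a b => eval N inp rho a - eval N inp rho b
  | EInp a => inp (eval N inp rho a)
  | ESum x a => \sum_(i < N) eval N inp (upd rho x i) a
  end.

(* [p] is the address of the code; the value is left in register [h], and the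
   registers above [h] are scratch. *)
Fixpoint compile (p h : nat) (e : expr) : program :=
  match e with
  | EVar x => [:: IConst h 0; IAdd h h x]
  | ECst c => [:: IConst h c]
  | EAdd a b =>
      let ca := compile p h a in
      ca ++ compile (p + size ca) h.+1 b ++ [:: IAdd h h h.+1]
  | ESub a b =>
      let ca := compile p h a in
      ca ++ compile (p + size ca) h.+1 b ++ [:: ISub h h h.+1]
  | EInp a => compile p h a ++ [:: IAdd h h 0; ILoad h h]
  | ESum x a =>
      let ca := compile (p + 5) h.+1 a in
      [:: IConst h 0; IAdd x 2 h; IJump x (p + 4);
          IJump 1 (p + 7 + size ca); ISub x x 1]
        ++ ca ++ [:: IAdd h h h.+1; IJump 1 (p + 2)]
  end.

Fixpoint time (N : nat) (e : expr) : nat :=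
  match e with
  | EVar _ => 2
  | ECst _ => 1
  | EAdd a b | ESub a b => time N a + time N b + 1
  | EInp a => time N a + 2
  | ESum _ a => N * (time N a + 4) + 4
  end.

Fixpoint height (e : expr) : nat :=
  match e with
  | EVar _ | ECst _ => 1
  | EAdd a b | ESub a b => maxn (height a) (height b).+1
  | EInp a => height a
  | ESum _ a => (height a).+1
  end.

Lemma height_gt0 e : 0 < height e.
Proof. by elim: e => //= a ? b ?; rewrite leq_max orbT. Qed.

(* [s] lists the readable variables, all below [k]; bound variables lie in
   [k, K) and increase inwards, so that no subexpression clobbers a variable
   which is live around it. *)
Fixpoint scoped (K : nat) (s : seq nat) (k : nat) (e : expr) : bool :=
  match e with
  | EVar x => x \in s
  | ECst _ => true
  | EAdd a b | ESub a b => scoped K s k a && scoped K s k b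
  | EInp a => scoped K s k a
  | ESum x a => [&& k <= x, x < K & scoped K (x :: s) x.+1 a]
  end.

Lemma eval_ext K N inp e s k rho rho' : scoped K s k e ->
  {in s, rho =1 rho'} -> eval N inp rho e = eval N inp rho' e.
Proof.
elim: e s k rho rho' => //= [x|a IHa b IHb|a IHa b IHb|a IHa|x a IHa] s k rho rho'.
- by move=> xs; apply.
- by case/andP=> sa sb rr; rewrite (IHa _ _ _ _ sa rr) (IHb _ _ _ _ sb rr).
- by case/andP=> sa sb rr; rewrite (IHa _ _ _ _ sa rr) (IHb _ _ _ _ sb rr).
- by move=> sa rr; rewrite (IHa _ _ _ _ sa rr).
case/and3P=> _ _ sa rr; apply: eq_bigr => i _; apply: IHa sa _ => y.
by rewrite inE !updE; case: eqP => //= _; apply: rr.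
Qed.

Section CompileCorrect.

Variables (P : program) (K M N : nat) (inp : nat -> nat).

(** The three ranges hold the variables live around the code, the pending temporaries of enclosing
    expressions, and the copy of the input. *)
Definition frame (h k : nat) (X X' : nat -> nat) : Prop :=
  forall y, [|| y < k, K <= y < h | M <= y] -> X' y = X y.

Definition env_ok (X : nat -> nat) : Prop :=
  [/\ M <= X 0, X 1 = 1, X 2 = N & forall i, X (X 0 + i) = inp i].

Lemma env_ok_frame h k X X' : 2 < k -> frame h k X X' -> env_ok X -> env_ok X'.
Proof.
move=> k2 fr [X0 X1 X2 Xi].
have E0 : X' 0 = X 0 by apply: fr; lia.
split; rewrite ?E0 //; try by rewrite fr //; lia.
by move=> i; rewrite fr ?Xi //; lia.
Qed.

Lemma frame_trans h k h' k' X X' X'' : h <= h' -> k <= k' ->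
  frame h k X X' -> frame h' k' X' X'' -> frame h k X X''.
Proof.
move=> hh kk f1 f2 y yP; rewrite f2 ?f1 //.
by case/or3P: yP => yP; apply/or3P; [apply: Or31|apply: Or32|apply: Or33]; lia.
Qed.

Lemma frame_upd h k X x v : K <= h -> k <= K -> h < M -> (k <= x < K) || (x == h) ->
  frame h k X (upd X x v).
Proof. by move=> *; move=> y yP; rewrite updE; case: eqP => // ?; lia. Qed.

Lemma compile_correct e p h s k X :
  code_at P p (compile p h e) -> scoped K s k e -> all (fun y => y < k) s ->
  2 < k <= K -> K <= h -> h + height e <= M -> env_ok X ->
  exists X', [/\ reaches P (time N e) (Config p X)
                   (Config (p + size (compile p h e)) X'),
                 X' h = eval N inp X e & frame h k X X'].
Proof.
elim: e p h s k X => [x|c|a IHa b IHb|a IHa b IHb|a IHa|x a IHa] p h s k X /=.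
- move=> /code_at_cons[s1 /code_at_cons[s2 _]] xs /allP sk k2 Kh hM eX.
  have xk := sk _ xs; exists (upd (upd X h 0) h (upd X h 0 h + upd X h 0 x)); split.
  + apply: reaches_step; rewrite s1 /=; apply: reaches_step; rewrite s2 /=.
    by rewrite addn2.
  + by rewrite !updE eqxx; case: eqP => [|//]; lia.
  + by move=> y yP; rewrite !updE; case: eqP => // ?; lia.
- move=> /code_at_cons[s1 _] xs /allP sk k2 Kh hM eX.
  exists (upd X h c); split.
  + by apply: reaches_step; rewrite s1 /= addn1.
  + by rewrite !updE eqxx.
  + by move=> y yP; rewrite !updE; case: eqP => // ?; lia.
- move=> /code_at_cat[ca /code_at_cat[cb /code_at_cons[s3 _]]] /andP[sa sb] sk k2 Kh hM eX.
  have [||Xa [ra va fa]] := IHa _ _ _ _ X ca sa sk k2 Kh; [lia|by []|].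
  have eXa : env_ok Xa by apply: env_ok_frame fa eX; lia.
  have [|||Xb [rb vb fb]] := IHb _ _ _ _ Xa cb sb sk k2; [lia|lia|by []|].
  exists (upd Xb h (Xb h + Xb h.+1)); split.
  + apply: (reaches_trans (reaches_trans ra rb)).
    apply: reaches_step; rewrite s3 /=.
    by rewrite /reaches /= !size_cat /=; congr Config; lia.
  + rewrite updE eqxx vb fb ?va; last by lia.
    congr addn; apply: eval_ext sb _ => y ys; apply: fa.
    by rewrite (allP sk).
  + have f2 : frame h k X Xb.
      by apply: (frame_trans (leqnSn h) (leqnn k) fa fb).
    by move=> y yP; rewrite updE; case: eqP => [?|_]; [lia|exact: f2].
- move=> /code_at_cat[ca /code_at_cat[cb /code_at_cons[s3 _]]] /andP[sa sb] sk k2 Kh hM eX.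
  have [||Xa [ra va fa]] := IHa _ _ _ _ X ca sa sk k2 Kh; [lia|by []|].
  have eXa : env_ok Xa by apply: env_ok_frame fa eX; lia.
  have [|||Xb [rb vb fb]] := IHb _ _ _ _ Xa cb sb sk k2; [lia|lia|by []|].
  exists (upd Xb h (Xb h - Xb h.+1)); split.
  + apply: (reaches_trans (reaches_trans ra rb)).
    apply: reaches_step; rewrite s3 /=.
    by rewrite /reaches /= !size_cat /=; congr Config; lia.
  + rewrite updE eqxx vb fb ?va; last by lia.
    congr subn; apply: eval_ext sb _ => y ys; apply: fa.
    by rewrite (allP sk).
  + have f2 : frame h k X Xb.
      by apply: (frame_trans (leqnSn h) (leqnn k) fa fb).
    by move=> y yP; rewrite updE; case: eqP => [?|_]; [lia|exact: f2].
- move=> /code_at_cat[ca /code_at_cons[s1 /code_at_cons[s2 _]]] sa sk k2 Kh hM eX.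
  have [||Xa [ra va fa]] := IHa _ _ _ _ X ca sa sk k2 Kh; [lia|by []|].
  have [Xa0 _ _ Xai] : env_ok Xa by apply: env_ok_frame fa eX; lia.
  exists (upd (upd Xa h (Xa h + Xa 0)) h (Xa (Xa h + Xa 0))); split.
  + apply: (reaches_trans ra).
    apply: reaches_step; rewrite s1 /=; apply: reaches_step; rewrite s2 /=.
    rewrite /reaches /= size_cat /=; congr Config; first by lia.
    congr upd; rewrite [in LHS]updE [upd _ _ _ h]updE eqxx.
    by case: eqP => // ?; have := height_gt0 a; lia.
  + by rewrite !updE eqxx addnC Xai va.
  + move=> y yP; rewrite !updE; case: eqP => [?|_]; last exact: fa.
    by have := height_gt0 a; lia.
move=> cP /and3P[kx xK sa] sk k2 Kh hM eX.
set ca := compile (p + 5) h.+1 a in cP *.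
have [c0 c1] := @code_at_cat P p [:: IConst h 0; IAdd x 2 h; IJump x (p + 4);
          IJump 1 (p + 7 + size ca); ISub x x 1] _ cP.
have [ca' /code_at_cons[s6 /code_at_cons[s7 _]]] := code_at_cat c1.
have [s1 /code_at_cons[s2 /code_at_cons[s3 /code_at_cons[s4 /code_at_cons[s5 _]]]]]
  := code_at_cons c0.
have sk' : all (fun y => y < x.+1) (x :: s).
  by rewrite /= ltnSn; apply/allP => y /(allP sk); lia.
(* The counter [x] runs down from [N], so the accumulator [h] holds the terms from [m] on. Besides
   the body, a round takes 4 steps: test, decrement, accumulate, jump back. The last 2 steps are the
   failed test and the exit jump. *)
have loop m : m <= N -> forall Y, Y x = m ->
    frame h x X Y -> Y h = \sum_(m <= i < N) eval N inp (upd X x i) a ->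
    exists X', [/\ reaches P (m * (time N a + 4) + 2) (Config p.+2 Y)
                   (Config (p + 7 + size ca) X'),
                 X' h = \sum_(0 <= i < N) eval N inp (upd X x i) a & frame h x X X'].
  elim: m => [|m IHm] mN Y Yx fY Yh.
    have [_ Y1 _ _] : env_ok Y by apply: env_ok_frame fY eX; lia.
    exists Y; split=> //.
    by do 2![apply: reaches_step; rewrite ?s3 ?s4 /= ?Yx ?Y1 /=].
  pose Z := upd Y x m.
  have fZ : frame h.+1 x.+1 Z Z by [].
  have fYZ : frame h x Y Z by apply: frame_upd; lia.
  have fXZ : frame h x X Z by apply: (frame_trans _ _ fY fYZ).
  have eZ : env_ok Z by apply: env_ok_frame fXZ eX; lia.
  have eY : env_ok Y by apply: env_ok_frame fY eX; lia.
  have [|||Xa [ra va fa]] := IHa _ _ _ _ Z ca' sa sk' _ _ _ eZ; try lia.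
  pose W := upd Xa h (Xa h + Xa h.+1).
  have fXa : frame h x X Xa by apply: (frame_trans _ _ fXZ fa).
  have fW : frame h x X W.
    by apply: (frame_trans (leqnn h) (leqnn x) fXa); apply: frame_upd; lia.
  have eW : env_ok W by apply: env_ok_frame fW eX; lia.
  have [|||X' [r' v' f']] := IHm _ W _ fW; first lia.
  - rewrite /W updE; case: eqP => [|_]; first lia.
    by rewrite fa ?ltnSn // /Z updE eqxx.
  - rewrite /W updE eqxx fa; last by lia.
    rewrite /Z updE; case: eqP => [|_]; first lia.
    rewrite Yh [in RHS]big_ltn; last by lia.
    rewrite addnC va; congr addn.
    apply: eval_ext sa _ => y; rewrite inE /Z !updE; case: eqP => //= _ ys.
    by rewrite fY //; have := allP sk _ ys; lia.
  exists X'; split=> //.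
  have -> : m.+1 * (time N a + 4) + 2
     = 2 + (time N a + (2 + (m * (time N a + 4) + 2))) by lia.
  have [_ Y1 _ _] := eY.
  have rZ : reaches P 2 (Config p.+2 Y) (Config (p + 5) Z).
    apply: reaches_step; rewrite s3 /= Yx /=; apply: reaches_step.
    rewrite addn4 s5 /= Yx Y1; rewrite /reaches /Z /= subn1.
    by congr Config; rewrite addnC.
  apply: (reaches_trans rZ (reaches_trans ra (reaches_trans _ r'))).
  have [_ W1 _ _] := eW.
  rewrite /= in s6 s7.
  apply: reaches_step; rewrite s6 /=; apply: reaches_step; rewrite s7 /=.
  by rewrite -/W W1 /= /reaches /= addn2.
have [X0 X1 X2 Xi] := eX.
pose Y := upd (upd X h 0) x N.
have [|||X' [r' v' f']] := loop N (leqnn N) Y.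
- by rewrite /Y updE eqxx.
- move=> y yP; rewrite /Y !updE; case: eqP => [?|_]; first by lia.
  by case: eqP => [?|//]; lia.
- by rewrite big_geq // /Y !updE eqxx; case: eqP => //; lia.
exists X'; split.
- have -> : N * (time N a + 4) + 4 = 2 + (N * (time N a + 4) + 2) by lia.
  have -> : p + (size (ca ++ [:: IAdd h h h.+1; IJump 1 (p + 2)])).+4.+1 = p + 7 + size ca.
    by rewrite size_cat /=; lia.
  apply: reaches_trans r'.
  do 2![apply: reaches_step; rewrite ?s1 ?s2 /=].
  rewrite /reaches /=; congr Config; congr upd.
  by rewrite !updE eqxx addn0; case: eqP => // ?; lia.
- by rewrite v' big_mkord.
- by move=> y yP; apply: f'; lia.
Qed.

End CompileCorrect.

(** * Logarithmic cost *)

(** The base [S.+1] is positive, so raising the exponent only weakens the bound, which gives closure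
    under sums. *)
Definition poly_bounded (f : nat -> nat) : Prop :=
  exists c d, forall S, f S <= c * S.+1 ^ d.

Lemma leq_exp_base m n d : m <= n -> m ^ d <= n ^ d.
Proof. by case: d => // d mn; rewrite leq_exp2r. Qed.

Lemma poly_bounded_const k : poly_bounded (fun=> k).
Proof. by exists k, 0 => S; rewrite expn0 muln1. Qed.

Lemma poly_bounded_id : poly_bounded id.
Proof. by exists 1, 1 => S; rewrite mul1n expn1. Qed.

Lemma poly_boundedD f g :
  poly_bounded f -> poly_bounded g -> poly_bounded (fun S => f S + g S).
Proof.
move=> [c [d fP]] [c' [d' gP]]; exists (c + c'), (d + d') => S.
rewrite mulnDl; apply: leq_add.
  by apply: leq_trans (fP S) _; rewrite leq_mul2l leq_pexp2l ?leq_addr ?orbT.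
by apply: leq_trans (gP S) _; rewrite leq_mul2l leq_pexp2l ?leq_addl ?orbT.
Qed.

Lemma poly_boundedM f g :
  poly_bounded f -> poly_bounded g -> poly_bounded (fun S => f S * g S).
Proof.
move=> [c [d fP]] [c' [d' gP]]; exists (c * c'), (d + d') => S.
by rewrite expnD mulnACA; apply: leq_mul.
Qed.

Lemma poly_bounded_time e : poly_bounded (fun N => time N e).
Proof.
pose pC := poly_bounded_const.
elim: e => [x|c|a IHa b IHb|a IHa b IHb|a IHa|x a IHa] /=.
- exact: pC.
- exact: pC.
- exact: poly_boundedD (poly_boundedD IHa IHb) (pC 1).
- exact: poly_boundedD (poly_boundedD IHa IHb) (pC 1).
- exact: poly_boundedD IHa (pC 2).
exact: poly_boundedD (poly_boundedM poly_bounded_id (poly_boundedD IHa (pC 4))) (pC 4).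
Qed.

Lemma bitlen_leq m v : 0 < m -> v < 2 ^ m -> bitlen v <= m.
Proof.
move=> m0 vm; rewrite /bitlen; have [->|v0] := posnP v; first by rewrite trunc_log0.
rewrite -(ltn_exp2l _ _ (isT : 1 < 2)).
by apply: leq_ltn_trans vm; apply: trunc_logP.
Qed.

Lemma ltn_bitlen v : v < 2 ^ bitlen v.
Proof. exact: trunc_log_ltn. Qed.

Lemma bitlen_gt0 v : 0 < bitlen v. Proof. by []. Qed.

Definition instr_size (ins : instr) : nat :=
  match ins with
  | IConst i j | ILoad i j | IStore i j | IJump i j => bitlen i + bitlen j
  | IAdd i j k | ISub i j k => bitlen i + bitlen j + bitlen k
  end.

Definition program_size (P : program) : nat := \sum_(ins <- P) instr_size ins.

Lemma onth_instr_size P p ins : onth P p = Some ins -> instr_size ins <= program_size P.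
Proof.
rewrite /program_size; elim: P p => [|a P IH] [|p] //=; rewrite big_cons.
  by case=> ->; rewrite leq_addr.
by move/IH/leq_trans; apply; rewrite leq_addl.
Qed.

Section Cost.

Variables (P : program) (input : seq nat).
Let S := input_length input.
Let C := program_size P.
Let run i := iter i (step P) (initial input).

Lemma size_input_length : size input <= S.
Proof.
rewrite /S /input_length -sum1_size; apply: leq_sum => x _; exact: bitlen_gt0.
Qed.

(* A step at most doubles the largest register. *)
Lemma reg_run_lt i y : 0 < S -> reg (run i) y < 2 ^ (S + C + i).
Proof.
move=> S0; elim: i y => [|i IHi] y.
  apply: (@leq_trans (2 ^ S)); last by rewrite leq_pexp2l //; lia.
  rewrite /run /=; case: y => [|y] /=.
    by apply: leq_ltn_trans size_input_length _; apply: ltn_expl.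
  have [yl|yl] := ltnP y (size input); last by rewrite nth_default ?expn_gt0.
  apply: leq_trans (ltn_bitlen _) _; rewrite leq_pexp2l //.
  by rewrite /S /input_length (big_nth 0) big_mkord (bigD1 (Ordinal yl)) //= leq_addr.
have H2 : 2 ^ (S + C + i.+1) = 2 ^ (S + C + i) + 2 ^ (S + C + i).
  by rewrite addnS expnS mul2n addnn.
have IH2 z : reg (run i) z < 2 ^ (S + C + i.+1) by rewrite H2; have := IHi z; lia.
rewrite /run iterS -/(run i) /step; case E: onth => [ins|] //.
case: ins E => [a c|a j k|a j k|a j|a j|j q] /onth_instr_size /= sz;
  rewrite ?updE; try (case: eqP => _ //).
- apply: leq_trans (ltn_bitlen _) _; rewrite leq_pexp2l //.
  by rewrite -/C in sz; lia.
- by rewrite H2; have := IHi j; have := IHi k; lia.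
- by apply: leq_ltn_trans (IH2 j); apply: leq_subr.
- exact: IH2.
Qed.

(** An instruction is charged for its own constants, at most [C], and for at most two register
    contents, each of at most [S + C + i] bits by [reg_run_lt]. *)
Lemma step_cost_le i : 0 < S -> step_cost P (run i) <= C + 2 * (S + C + i).
Proof.
move=> S0; rewrite /step_cost; case E: onth => [ins|] //.
have b y : bitlen (reg (run i) y) <= S + C + i.
  by apply: bitlen_leq; [lia|apply: reg_run_lt].
have sz := onth_instr_size E; rewrite -/C in sz.
case: ins E sz => [a c|a j k|a j k|a j|a j|j q] E /= sz.
- by lia.
- by have := b j; have := b k; lia.
- by have := b j; have := b k; lia.
- by have := b j; have := b (reg (run i) j); lia.
- by have := b j; have := b a; lia.
- by have := b j; lia.
Qed.

Lemma computes_within_steps t X out : 0 < S ->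
  reaches P t (initial input) (Config (size P) X) -> X 0 = out ->
  computes_within P input out (t * (C + 2 * (S + C + t))).
Proof.
move=> S0 rP X0; exists t; split.
- by rewrite rP /halted /=.
- by rewrite rP.
rewrite -[X in _ <= X * _](card_ord t) -sum_nat_const; apply: leq_sum => i _.
by apply: leq_trans (step_cost_le _ S0) _; have := ltn_ord i; lia.
Qed.

End Cost.

(** In the absence of multiplication the bit length of registers grows at most linearly with the
    number of steps, so polynomially many steps have polynomial logarithmic cost. *)
Lemma polytime_on_steps (T : Type) (encode : T -> seq nat) (D : T -> Prop)
    (f : T -> nat) (P : program) (g : nat -> nat) :
  poly_bounded g ->
  (forall x, D x -> 0 < size (encode x)) ->
  (forall x, D x -> exists t X, [/\ t <= g (input_length (encode x)),
     reaches P t (initial (encode x)) (Config (size P) X) & X 0 = f x]) ->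
  polytime_on encode D f.
Proof.
move=> gP szP stepsP; set C := program_size P.
have [c [d cP]] : poly_bounded (fun S => g S * (C + 2 * (S + C + g S))).
  have pC := poly_bounded_const; have pi := poly_bounded_id.
  apply: (poly_boundedM gP); apply: poly_boundedD => //; apply: poly_boundedM => //.
  by apply: poly_boundedD => //; apply: poly_boundedD.
(* The factor [2 ^ d] comes from [S.+1 <= 2 * S], valid for positive [S]. *)
exists P, (c * 2 ^ d), d => x Dx.
have [t [X [tg rX X0]]] := stepsP x Dx.
have S0 : 0 < input_length (encode x).
  exact: leq_trans (szP _ Dx) (size_input_length _).
have [t' [h1 h2 h3]] := computes_within_steps S0 rX X0.
exists t'; split=> //; apply: leq_trans h3 _.
set S := input_length _ in S0 tg *.
apply: (@leq_trans (c * S.+1 ^ d)).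
  apply: leq_trans (cP S); rewrite -/C; apply: leq_mul => //.
  by rewrite leq_add2l leq_mul2l /= leq_add2l.
apply: leq_trans (leq_addr _ _); rewrite -mulnA -expnMn leq_mul2l.
by apply/orP; right; apply: leq_exp_base; lia.
Qed.

(** * Relocation of the input *)

(** On entry [X_0] is [B + 1]. Inputs 1 to 5 move to [B + 1], ..., [B + 5], which frees their
    registers: [X_1] becomes the increment, [X_2] the source pointer, [X_4] a countdown and [X_5] a
    record of [B + 5]. *)
Definition save_code : program :=
  [:: IStore 0 1; IConst 1 1;
      IAdd 0 0 1; IStore 0 2; IAdd 0 0 1; IStore 0 3;
      IAdd 0 0 1; IStore 0 4; IAdd 0 0 1; IStore 0 5;
      IConst 2 5; IConst 3 0; IAdd 4 0 3; IAdd 5 0 3].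

Definition copy_code (q : nat) : program :=
  [:: IAdd 0 0 1; IAdd 2 2 1; ILoad 3 2; IStore 0 3; ISub 4 4 1; IJump 4 q].

(* With only X_0 free at the start, doubling it is the way to reach addresses
   beyond the input. *)
Definition relocate : program :=
  nseq 8 (IAdd 0 0 0) ++ save_code ++ copy_code 22 ++
  [:: IConst 3 5; ISub 0 5 3; IAdd 3 0 1; ILoad 2 3].

Lemma double_correct P k p X : code_at P p (nseq k (IAdd 0 0 0)) ->
  exists X', [/\ reaches P k (Config p X) (Config (p + k) X'),
    X' 0 = 2 ^ k * X 0 & forall y, 0 < y -> X' y = X y].
Proof.
elim: k p X => [|k IH] p X.
  by move=> _; exists X; rewrite addn0 mul1n; split.
move=> /code_at_cons[s1 cP]; have [X' [rX X0 Xy]] := IH _ (upd X 0 (X 0 + X 0)) cP.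
exists X'; split.
- by apply: reaches_step; rewrite s1 -addSnnS.
- by rewrite X0 updE eqxx expnS; lia.
- by move=> y y0; rewrite Xy // updE; case: eqP => // ?; lia.
Qed.

Section Relocate.

Variables (P : program) (inp : nat -> nat) (B : nat).
Hypothesis B16 : 16 <= B.

Definition saved (m : nat) (X : nat -> nat) : Prop :=
  [/\ X 0 = B + m, X 1 = 1,
      forall y, m < y <= B -> X y = inp y &
      forall i, 0 < i <= m -> X (B + i) = inp i].

Lemma save_step m p X : code_at P p [:: IAdd 0 0 1; IStore 0 m.+1] ->
  0 < m < 5 -> saved m X ->
  exists2 X', reaches P 2 (Config p X) (Config (p + 2) X') & saved m.+1 X'.
Proof.
move=> /code_at_cons[s1 /code_at_cons[s2 _]] m0 [X0 X1 Xy Xs].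
exists (upd (upd X 0 (B + m.+1)) (B + m.+1) (inp m.+1)).
  apply: reaches_step; rewrite s1 /=; apply: reaches_step; rewrite s2 /=.
  by rewrite /reaches /= X0 X1 addn2 !updE /= addn1 -addnS Xy //; lia.
split.
- by rewrite !updE; case: eqP => //; lia.
- by rewrite !updE; case: eqP => //; lia.
- move=> y yP; rewrite !updE; case: eqP => [|_]; first by lia.
  by case: eqP => [|_]; [lia|apply: Xy; lia].
move=> i iP; rewrite !updE; case: eqP => [E|ne]; first by congr inp; lia.
by case: eqP => [|_]; [lia|apply: Xs; lia].
Qed.

Lemma save_correct p X : code_at P p save_code ->
  X 0 = B.+1 -> (forall y, 0 < y <= B -> X y = inp y) ->
  exists X', [/\ reaches P 14 (Config p X) (Config (p + 14) X'),
    saved 5 X', X' 2 = 5, X' 4 = B + 5 & X' 5 = B + 5].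
Proof.
move=> /code_at_cons[s1 /code_at_cons[s2]].
move=> /(@code_at_cat _ _ [:: IAdd 0 0 1; IStore 0 2])[c2].
move=> /(@code_at_cat _ _ [:: IAdd 0 0 1; IStore 0 3])[c3].
move=> /(@code_at_cat _ _ [:: IAdd 0 0 1; IStore 0 4])[c4].
move=> /(@code_at_cat _ _ [:: IAdd 0 0 1; IStore 0 5])[c5].
move=> /code_at_cons[t1 /code_at_cons[t2 /code_at_cons[t3 /code_at_cons[t4 _]]]] X0 Xy.
pose X1 := upd (upd X B.+1 (X 1)) 1 1.
have r1 : reaches P 2 (Config p X) (Config p.+2 X1).
  apply: reaches_step; rewrite s1 /=; apply: reaches_step; rewrite s2 /=.
  by rewrite /reaches /= X0.
have sv1 : saved 1 X1.
  split; rewrite /X1.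
  - by rewrite !updE /= X0 addn1.
  - by [].
  - by move=> y yP; rewrite !updE; do 2!(case: eqP => [|_]; first by lia); apply: Xy; lia.
  - move=> i iP; have -> : i = 1 by lia.
    by rewrite !updE addn1 eqxx; case: eqP => [|_]; [lia|apply: Xy; lia].
have [//|X2 r2 sv2] := save_step c2 _ sv1.
have [//|X3 r3 sv3] := save_step c3 _ sv2.
have [//|X4 r4 sv4] := save_step c4 _ sv3.
have [//|X5 r5 [e0 e1 ey es]] := save_step c5 _ sv4.
exists (upd (upd (upd (upd X5 2 5) 3 0) 4 (B + 5)) 5 (B + 5)); split => //.
  rewrite -[14]/(2 + (2 + (2 + (2 + (2 + 4))))).
  apply: (reaches_trans r1); apply: (reaches_trans r2).
  apply: (reaches_trans r3); apply: (reaches_trans r4).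
  apply: (reaches_trans r5); rewrite /= in t1 t2 t3 t4.
  apply: reaches_step; rewrite t1 /=; apply: reaches_step; rewrite t2 /=.
  apply: reaches_step; rewrite t3 /=; apply: reaches_step; rewrite t4 /=.
  rewrite /reaches /= !updE /= e0 !addn0; congr Config; lia.
split=> //.
  by move=> y yP; rewrite !updE; do 4!(case: eqP => [|_]; first by lia); apply: ey.
by move=> i iP; rewrite !updE; do 4!(case: eqP => [|_]; first by lia); apply: es.
Qed.

(** All writes to the copy go above [B], so sources up to [B] are intact. The loop continues past
    [s = B] and then rereads its own output; the minimum excludes those cells. *)
Definition copied (s c : nat) (X : nat -> nat) : Prop :=
  [/\ [/\ X 0 = B + s, X 1 = 1, X 2 = s, X 4 = c & X 5 = B + 5],
      forall y, 5 < y <= B -> X y = inp y &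
      forall i, 0 < i <= minn s B -> X (B + i) = inp i].

Lemma copy_step q c s X : code_at P q (copy_code q) ->
  5 <= s -> copied s c.+1 X ->
  exists2 X', reaches P 6 (Config q X) (Config (if 0 < c then q else q + 6) X') &
    copied s.+1 c X'.
Proof.
move=> /code_at_cons[s1 /code_at_cons[s2 /code_at_cons[s3
  /code_at_cons[s4 /code_at_cons[s5 /code_at_cons[s6 _]]]]]].
move=> s5' [[X0 X1 X2 X4 X5] Xy Xi].
pose Y := upd (upd (upd (upd (upd X 0 (B + s.+1)) 2 s.+1) 3 (X s.+1))
                 (B + s.+1) (X s.+1)) 4 c.
exists Y.
  do 6![apply: reaches_step; rewrite ?s1 ?s2 ?s3 ?s4 ?s5 ?s6 /=].
  have n2 : (s.+1 == 2) = false by lia.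
  have n0 : (s.+1 == 0) = false by [].
  have n4 : (4 == B + s.+1) = false by lia.
  have n1 : (1 == B + s.+1) = false by lia.
  rewrite /reaches /= ?updE /= X0 X1 X2 !addn1 -!addnS ?updE /= ?n2 ?n4 ?n1 ?X1 ?X4.
  by rewrite subn1 (addnC q).
have Y1 : Y 1 = 1 by rewrite /Y !updE /=; case: eqP => //; lia.
split; first by split=> //; rewrite /Y ?updE //=; case: eqP => //; lia.
  move=> y yP; rewrite /Y !updE; do 5!(case: eqP => [|_]; first by lia); exact: Xy.
move=> i iP; rewrite /Y !updE; case: eqP => [|_]; first by lia.
case: eqP => [E|ne]; first by (have -> : i = s.+1 by lia); apply: Xy; lia.
by do 3!(case: eqP => [|_]; first by lia); apply: Xi; lia.
Qed.

Lemma copy_correct q c s X : code_at P q (copy_code q) ->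
  5 <= s -> copied s c.+1 X ->
  exists2 X', reaches P (6 * c.+1) (Config q X) (Config (q + 6) X') &
    copied (s + c.+1) 0 X'.
Proof.
move=> cP; elim: c s X => [|c IH] s X s5 sX; have [Y rY sY] := copy_step cP s5 sX.
  by exists Y; rewrite ?addn1.
have [|X' r' s'] := IH s.+1 Y _ sY; first by lia.
exists X'; last by rewrite -addSnnS.
have -> : 6 * c.+2 = 6 + 6 * c.+1 by lia.
exact: reaches_trans rY r'.
Qed.

End Relocate.

Lemma relocate_correct P input : code_at P 0 relocate -> 0 < size input ->
  let B := (2 ^ 8 * size input).-1 in
  exists t X, [/\ t <= 2000 * (size input),
    reaches P t (initial input) (Config (size relocate) X),
    X 0 = B, X 1 = 1 &
    (X 2 = nth 0 input 0) /\ (forall i, i < size input -> X (B + i.+1) = nth 0 input i)].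
Proof.
move=> cP sz B.
have [c1 /code_at_cat[c2 /code_at_cat[c3
  /code_at_cons[s1 /code_at_cons[s2 /code_at_cons[s3 /code_at_cons[s4 _]]]]]]] := code_at_cat cP.
rewrite !size_nseq in c2 c3 s1 s2 s3 s4; rewrite /= in s1 s2 s3 s4.
pose inp := nth 0 (size input :: input).
have B16 : 16 <= B by rewrite /B; lia.
have [X1 [r1 e0 ey]] := double_correct (reg (initial input)) c1.
have [||X2 [r2 [d0 d1 dy ds] d2 d4 d5]] := @save_correct P inp B B16 _ X1 c2.
- by rewrite e0 /= /B; lia.
- by move=> y /andP[y0 _]; rewrite ey.
have [||X3 r3 [[_ f1 _ _ f5] _ fi]] := @copy_correct P inp B B16 _ (B + 4) 5 X2 c3.
- by [].
- split; first by split=> //; lia.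
    exact: dy.
  by move=> i iP; apply: ds; lia.
pose X := upd (upd (upd (upd X3 3 5) 0 B) 3 B.+1) 2 (nth 0 input 0).
exists (8 + (14 + (6 * (B + 4).+1 + 4))), X; split.
(* Six steps for each of [B + 5] cells, with [B < 256 * size input]: the total is
   [1536 * size input + 50]. *)
- by rewrite /B; lia.
- apply: (reaches_trans r1); apply: (reaches_trans r2); apply: (reaches_trans r3).
  apply: reaches_step; rewrite s1 /=; apply: reaches_step; rewrite s2 /=.
  apply: reaches_step; rewrite s3 /=; apply: reaches_step; rewrite s4 /=.
  rewrite /reaches /= ?updE /= f5 f1 addnK addn1 ?updE /=.
  have -> : B.+1 == 3 = false by lia.
  have -> : X3 B.+1 = nth 0 input 0 by rewrite -addn1 fi //; lia.
  by [].
- by rewrite /X !updE.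
- by rewrite /X !updE.
split; first by rewrite /X updE.
move=> i iL; rewrite /X !updE; do 3!(case: eqP => [|_]; first by lia).
by rewrite fi //; rewrite /B; lia.
Qed.

(** * Two-sided typed instances *)

Definition better n (b : bool) (x y : 'I_n) : bool := if b then x < y else y < x.

Lemma better_trans n b (x y z : 'I_n) : better b x y -> better b y z -> better b x z.
Proof. by rewrite /better; case: b; lia. Qed.

Lemma better_irr n b (x : 'I_n) : better b x x = false.
Proof. by rewrite /better ltnn if_same. Qed.

Lemma better_total n b (x y : 'I_n) : x != y -> better b x y || better b y x.
Proof. by rewrite -val_eqE neq_ltn /better; case: b; rewrite // orbC. Qed.

Lemma card_ord_lt n (j : 'I_n) : #|[set j' : 'I_n | j' < j]| = j.
Proof.
rewrite cardsE -sum1_card -(big_ord_widen n (fun=> 1)) ?sum1_card ?card_ord //.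
exact: ltnW.
Qed.

Section Typed.

(* Men and women are given by rank, 0 being the top; [mt i] means that man i
   prefers women of low rank, and [wt] is the same for women. *)
Variables (n : nat) (mt wt : 'I_n -> bool).

(** Irreflexivity of [better] takes care of the pairs that are matched to each other. *)
Definition tstable (pi : 'S_n) : bool :=
  [forall i, forall j, ~~ (better (mt i) j (pi i) && better (wt j) i (pi^-1 j))].

Implicit Types (g : {ffun 'I_n -> bool}) (pi : 'S_n).

(* [pairs g] is the only candidate for a stable matching in which the partner
   of woman j has type [g j]. *)
Definition pairs g (i j : 'I_n) : bool :=
  (g j == mt i) &&
  (#|[set i' | better (wt j) i' i && (mt i' == mt i)]| ==
   #|[set j' | [&& better (mt i) j' j, g j' == g j & wt j' == wt j]]|).

Definition conflict (i j i' j' : 'I_n) : bool :=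
  ((i == i') != (j == j')) || (better (mt i) j' j && better (wt j') i i').

(** Says that [pairs g] is the graph of a stable matching, with quantifiers over persons only, so
    that bounded sums can evaluate it. *)
Definition realizable g : bool :=
  [forall j, exists i, pairs g i j] &&
  [forall i, forall j, forall i', forall j',
    ~~ [&& pairs g i j, pairs g i' j' & conflict i j i' j']].

Definition pattern pi : {ffun 'I_n -> bool} := [ffun j => mt (pi^-1 j)].

Lemma tstableP pi i j : tstable pi ->
  better (mt i) j (pi i) -> better (wt j) i (pi^-1 j) -> False.
Proof. by move/forallP/(_ i)/forallP/(_ j) => + b1 b2; rewrite b1 b2. Qed.

(** [pi] maps the first counted set onto the second. If [pi i] prefers [i'], of the type of [i],
    then [i] prefers [pi i'] to [pi i], else [i'] and [pi i] block; and [pi i'] has the type of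
    [pi i], else she prefers [i] to [i'] and blocks with him. The converse is similar. *)
Lemma pairs_stable pi i : tstable pi -> pairs (pattern pi) i (pi i).
Proof.
move=> st; rewrite /pairs ffunE permK eqxx /=; apply/eqP.
rewrite -(card_imset _ (@perm_inj _ pi)); congr #|pred_of_set _|.
apply/setP => j; apply/imsetP/idP.
  case=> i'; rewrite inE => /andP[bi /eqP ti] ->; rewrite inE !ffunE !permK ti eqxx /=.
  have ne : pi i' != pi i.
    by apply: contraTneq bi => /perm_inj ->; rewrite better_irr.
  have bj : better (mt i) (pi i') (pi i).
    have /orP[//|bj] := better_total (mt i) ne.
    by case: (tstableP (i := i') (j := pi i) st); rewrite ?permK ?ti.
  rewrite bj /=; apply/negPn/negP => wne.
  apply: (tstableP (i := i) (j := pi i') st) => //; rewrite permK.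
  by move: bi wne; rewrite /better; case: (wt _); case: (wt _).
rewrite inE ffunE => /and3P[bj /eqP ti /eqP tw].
exists (pi^-1 j); last by rewrite permKV.
rewrite inE ti eqxx andbT.
have ne : pi^-1 j != i by apply: contraTneq bj => <-; rewrite permKV better_irr.
have /orP[//|bi] := better_total (wt (pi i)) ne.
by case: (tstableP (i := i) (j := j) st); rewrite ?tw.
Qed.

(** Both men have type [g j]. The count of women is then the same for both, while the count of men
    grows strictly as [j] descends her list within that type. *)
Lemma pairs_inj g i i' j : pairs g i j -> pairs g i' j -> i = i'.
Proof.
suff H i1 i2 : pairs g i1 j -> pairs g i2 j -> better (wt j) i1 i2 -> False.
  move=> p p'; apply: contraTeq isT => /(better_total (wt j)) /orP[] b.
    by case: (H i i' p p' b).
  by case: (H i' i p' p b).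
move=> /andP[/eqP g1 /eqP c1] /andP[/eqP g2 /eqP c2] b.
have t12 : mt i1 = mt i2 by rewrite -g1 -g2.
have : #|[set i' | better (wt j) i' i1 && (mt i' == mt i1)]| <
       #|[set i' | better (wt j) i' i2 && (mt i' == mt i2)]|.
  apply: proper_card; apply/properP; split.
    apply/subsetP => x; rewrite !inE t12 => /andP[bx ->].
    by rewrite (better_trans bx b).
  by exists i1; rewrite inE ?better_irr // b t12 eqxx.
by rewrite c1 c2 t12 ltnn.
Qed.

Lemma pairs_patternE pi i j : tstable pi -> pairs (pattern pi) i j = (pi i == j).
Proof.
move=> st; apply/idP/eqP => [p|<-]; last exact: pairs_stable.
have := pairs_stable (pi^-1 j) st; rewrite permKV => /(pairs_inj p) ->.
by rewrite permKV.
Qed.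

Lemma realizable_pattern pi : tstable pi -> realizable (pattern pi).
Proof.
move=> st; apply/andP; split.
  by apply/forallP => j; apply/existsP; exists (pi^-1 j); rewrite pairs_patternE ?permKV.
apply/forallP => i; apply/forallP => j; apply/forallP => i'; apply/forallP => j'.
rewrite !pairs_patternE //; apply/and3P => -[/eqP <- /eqP <- /orP[|/andP[b1 b2]]].
  by rewrite (inj_eq perm_inj) eqxx.
by apply: (tstableP (i := i) (j := pi i') st); rewrite ?permK.
Qed.

Lemma pattern_inj : {in tstable &, injective pattern}.
Proof.
move=> p p' st st' E; apply/permP => i; apply/esym/eqP.
by rewrite -pairs_patternE // -E pairs_stable.
Qed.

Lemma realizableP g : realizable g -> exists2 pi, tstable pi & g = pattern pi.
Proof.
case/andP => /forallP ex /forallP nc.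
have ncP i j i' j' : pairs g i j -> pairs g i' j' -> ~~ conflict i j i' j'.
  move=> p p'; have /forallP/(_ j)/forallP/(_ i')/forallP/(_ j') := nc i.
  by rewrite p p'.
have exP j := existsP (ex j); pose f j := xchoose (exP j).
have fP j : pairs g (f j) j := xchooseP (exP j).
have f_inj : injective f.
  move=> j j' E; have := ncP _ _ _ _ (fP j) (fP j').
  by rewrite /conflict E eqxx negb_or negbK => /andP[/eqP/esym/eqP].
(* [f] sends women to men, so the matching is its inverse. *)
pose pi := (perm f_inj)^-1.
have piV j : pi^-1 j = f j by rewrite /pi invgK permE.
have pP i : pairs g i (pi i) by rewrite -{1}(permK pi i) piV.
exists pi.
  apply/forallP => i; apply/forallP => j; rewrite piV.
  by have := ncP _ _ _ _ (pP i) (fP j); rewrite /conflict negb_or => /andP[].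
by apply/ffunP => j; rewrite ffunE piV; have /andP[/eqP] := fP j.
Qed.

Lemma card_tstable : #|[set pi | tstable pi]| = #|[set g | realizable g]|.
Proof.
rewrite -(card_in_imset (f := pattern)); last first.
  by move=> p p'; rewrite !inE; apply: pattern_inj.
congr #|pred_of_set _|; apply/setP => g; apply/imsetP/idP.
  by case=> p; rewrite !inE => st ->; apply: realizable_pattern.
by rewrite inE => /realizableP[p st ->]; exists p; rewrite ?inE.
Qed.

(** * The possible patterns: sorted and mixed *)

Definition sorted_pattern : {ffun 'I_n -> bool} :=
  [ffun j : 'I_n => j < #|[set i | mt i]|].

Definition mixed_pattern (p q : 'I_n) : {ffun 'I_n -> bool} :=
  [ffun j : 'I_n => (j < p) || (j <= q) && (wt j != wt p)].

Definition mixed_ends (p q : 'I_n) : bool := (p < q) && (wt p != wt q).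

Lemma mixed_patternP p q : mixed_ends p q ->
  [/\ forall j : 'I_n, j < p -> mixed_pattern p q j, mixed_pattern p q p = false,
      mixed_pattern p q q & forall j : 'I_n, q < j -> mixed_pattern p q j = false].
Proof.
rewrite /mixed_ends => /andP[pq wpq]; split=> [j jp|||j qj]; rewrite ffunE.
- by rewrite jp.
- by rewrite ltnn eqxx andbF.
- by rewrite leqnn eq_sym wpq orbT.
- by apply/norP; split; rewrite ?negb_and; lia.
Qed.

(** The pattern determines [p] as its first false entry and [q] as its last true one. *)
Lemma mixed_pattern_inj p q p' q' : mixed_ends p q -> mixed_ends p' q' ->
  mixed_pattern p q = mixed_pattern p' q' -> (p, q) = (p', q').
Proof.
move=> /mixed_patternP[a b c d] /mixed_patternP[a' b' c' d'] E.
rewrite E in a b c d; congr pair; apply: val_inj => /=.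
  have [/a'|/a|//] := ltngtP p p'; first by rewrite b.
  by rewrite b'.
have [/d|/d'|//] := ltngtP q q'; first by rewrite c'.
by rewrite c.
Qed.

Lemma mixed_not_sorted p q : mixed_ends p q -> mixed_pattern p q != sorted_pattern.
Proof.
move=> pq; have [_ b c _] := mixed_patternP pq; apply/eqP => E.
by move: b c pq; rewrite E !ffunE /mixed_ends; lia.
Qed.

(* A woman whose man likes low ranks, below one whose man likes high ranks: the
   two men envy each other, so the two women must have opposite types. *)
Lemma inversion_types pi (j' j : 'I_n) : tstable pi ->
  j' < j -> pattern pi j' = false -> pattern pi j -> wt j' != wt j.
Proof.
rewrite !ffunE => st jj t' t; apply/eqP => E.
have ne : pi^-1 j != pi^-1 j' by apply: contraTneq t => ->; rewrite t'.
have /orP[b|b] := better_total (wt j) ne.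
  by apply: (tstableP (i := pi^-1 j) (j := j') st); rewrite ?t ?permKV ?E.
by apply: (tstableP (i := pi^-1 j') (j := j) st); rewrite ?t' ?permKV.
Qed.

Lemma pattern_cases pi : tstable pi ->
  pattern pi = sorted_pattern \/
  exists p q, mixed_ends p q /\ pattern pi = mixed_pattern p q.
Proof.
move=> st; set g := pattern pi.
have inv (j' j : 'I_n) : j' < j -> g j' = false -> g j -> wt j' != wt j.
  by move=> *; apply: inversion_types st _ _ _.
have [/existsP[a /existsP[b /and3P[ab ga gb]]]|] :=
  boolP [exists j' : 'I_n, exists j : 'I_n, [&& j' < j, ~~ g j' & g j]].
  right.
  have [p gp pmin] := @arg_minnP _ a (fun j => ~~ g j) (fun j : 'I_n => j : nat) ga.
  have [q gq qmax] := @arg_maxnP _ b (fun j => g j) (fun j : 'I_n => j : nat) gb.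
  have gp' := negbTE gp.
  have pq : p < q by have := pmin a ga; have := qmax b gb; lia.
  have wpq := inv _ _ pq gp' gq.
  exists p, q; split; first by rewrite /mixed_ends pq.
  apply/ffunP => j; rewrite [RHS]ffunE -/g.
  have [jp|pj] := ltnP j p.
    by apply: contraTT jp => /pmin; rewrite -leqNgt.
  have [jq|qj] := leqP j q; last first.
    by apply/negbTE/negP => /qmax /=; lia.
  (* A true entry after [p] forces the type opposite to that of [p]; a false entry before [q] forces
     the type opposite to that of [q], which is that of [p]. *)
  case E : (g j).
    apply/esym; rewrite eq_sym; apply: inv => //; rewrite ltn_neqAle pj andbT.
    by apply: contraFneq gp' => /val_inj ->.
  have jq' : j < q.
    rewrite ltn_neqAle jq andbT; apply: contraFneq E => /val_inj ->; exact: gq.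
  have := inv _ _ jq' E gq; move: wpq.
  by case: (wt p); case: (wt q); case: (wt j).
move=> noinv; left.
have closed (j' j : 'I_n) : j' < j -> g j -> g j'.
  move=> jj gj; apply: contraNT noinv => gj'.
  by apply/existsP; exists j'; apply/existsP; exists j; rewrite jj gj' gj.
(* [pi] carries the men of true type onto the women with true pattern. *)
have cardg : #|[set i | mt i]| = #|[set j | g j]|.
  rewrite -(card_imset _ (@perm_inj _ pi)); congr #|pred_of_set _|.
  apply/setP => j; rewrite -{1}(permKV pi j) mem_imset ?inE ?ffunE //.
  exact: perm_inj.
(* The true entries form an initial segment, so comparing it with the [j] women before [j] decides
   whether [j] belongs to it. *)
apply/ffunP => j; rewrite [RHS]ffunE cardg; case E : (g j); apply/esym.
  rewrite -[X in X < _]card_ord_lt; apply: proper_card; apply/properP; split.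
    by apply/subsetP => x; rewrite !inE => /closed; apply.
  by exists j; rewrite inE ?ltnn.
apply/negbTE; rewrite -leqNgt -[X in _ <= X]card_ord_lt; apply: subset_leq_card.
apply/subsetP => x; rewrite !inE => gx; rewrite ltnNge; apply/negP => jx.
move: jx; rewrite leq_eqVlt => /orP[/eqP/val_inj jx|/closed/(_ gx)].
  by rewrite jx gx in E.
by rewrite E.
Qed.

(** Mixed patterns with different ends differ from each other and from the sorted one, so nothing is
    counted twice. *)
Lemma card_tstable_patterns :
  #|[set pi | tstable pi]| =
  realizable sorted_pattern +
  \sum_p \sum_q (mixed_ends p q && realizable (mixed_pattern p q)).
Proof.
rewrite card_tstable (cardsD1 sorted_pattern) inE; congr addn.
pose D := [set pq | mixed_ends pq.1 pq.2 && realizable (mixed_pattern pq.1 pq.2)].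
transitivity #|D|.
  rewrite -(card_in_imset (f := fun pq => mixed_pattern pq.1 pq.2)); last first.
    move=> [p q] [p' q']; rewrite !inE /= => /andP[e _] /andP[e' _].
    exact: mixed_pattern_inj.
  congr #|pred_of_set _|; apply/setP => g; rewrite !inE; apply/idP/imsetP.
    case/andP=> ns /[dup] rg /realizableP[pi st E].
    have [E'|[p [q [e E']]]] := pattern_cases st.
      by rewrite E E' eqxx in ns.
    by exists (p, q); rewrite ?inE /= -?E' -?E ?e.
  by case=> [[p q]]; rewrite inE /= => /andP[e rg] ->; rewrite mixed_not_sorted.
rewrite pair_big /= -sum1_card big_mkcond /=; apply: eq_bigr => pq _.
by rewrite inE; case: (_ && _).
Qed.

End Typed.

(** * From one-attribute instances to typed instances *)

Lemma nth_allpairs_enum n (f : 'I_n -> 'I_n -> nat) (i j : 'I_n) :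
  nth 0 [seq f x y | x <- enum 'I_n, y <- enum 'I_n] (i * n + j) = f i j.
Proof.
have H (s : seq 'I_n) k : k < size s ->
  nth 0 [seq f x y | x <- s, y <- enum 'I_n] (k * n + j) = f (nth i s k) j.
  elim: s k => [|x s IH] [|k] //= ks; rewrite nth_cat size_map size_enum_ord.
    by rewrite mul0n add0n ltn_ord (nth_map j) ?size_enum_ord ?ltn_ord ?nth_ord_enum.
  by rewrite mulSn -addnA ltnNge leq_addr /= addKn IH.
by rewrite H ?size_enum_ord // nth_ord_enum.
Qed.

Section Encoding.

Variable I : sm_instance.
Let n := sm_size I.

Lemma size_encode_sm : size (encode_sm I) = (n * n + n * n).+1.
Proof. by rewrite /= size_cat !size_allpairs !size_enum_ord. Qed.

Lemma nth_encode_mlist (m k : 'I_n) :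
  nth 0 (encode_sm I) (m * n + k).+1 = mlist m k.
Proof.
rewrite /= nth_cat size_allpairs !size_enum_ord -/n.
have -> : m * n + k < n * n by have := ltn_ord m; have := ltn_ord k; nia.
by rewrite nth_allpairs_enum.
Qed.

Lemma nth_encode_wlist (w k : 'I_n) :
  nth 0 (encode_sm I) (n * n + (w * n + k)).+1 = wlist w k.
Proof.
rewrite /= nth_cat size_allpairs !size_enum_ord -/n.
by rewrite ltnNge leq_addr /= addKn nth_allpairs_enum.
Qed.

End Encoding.

(** Only the sign of [pre m] matters: the list of [m] is that of [i0] or its reverse, and the first
    choice, at index [i0 = 0], tells which. *)
Lemma one_attribute_better (R : realType) n (l : 'I_n -> 'S_n) (pre pos : 'I_n -> R)
    (i0 m x y : 'I_n) :
  i0 = 0 :> nat ->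
  (forall m, injective (fun w => pre m * pos w)%R) ->
  (forall m w w', (l m)^-1 w < (l m)^-1 w' <-> (pre m * pos w > pre m * pos w')%R) ->
  ((l m)^-1 (l i0 x) < (l m)^-1 (l i0 y)) = better (l m i0 == l i0 i0) x y.
Proof.
move=> i00 inj pref.
have [->|xy] := eqVneq x y; first by rewrite better_irr ltnn.
have prefE k w w' : ((l k)^-1 w < (l k)^-1 w') = (pre k * pos w > pre k * pos w')%R.
  by apply/idP/idP => /pref.
(* A zero preference value makes all products equal, contradicting injectivity at two distinct
   points. *)
have ne0 k : pre k != 0%R.
  apply: contra_neq xy => k0; apply: (perm_inj (s := l i0)); apply: (inj k).
  by rewrite k0 !mul0r.
have i0_min (z : 'I_n) : (z < i0) = false by rewrite i00.
have i0_lt (z : 'I_n) : z != i0 -> i0 < z by rewrite -val_eqE /= i00 lt0n.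
have [s|s] : (forall w w', ((l m)^-1 w < (l m)^-1 w') = ((l i0)^-1 w < (l i0)^-1 w')) \/
    (forall w w', ((l m)^-1 w < (l m)^-1 w') = ((l i0)^-1 w' < (l i0)^-1 w)).
  have [pm|pm] := ltP 0%R (pre m); have [p0|p0] := ltP 0%R (pre i0).
  - by left=> w w'; rewrite !prefE !ltr_pM2l.
  - have {}p0 : (pre i0 < 0)%R by rewrite lt_neqAle ne0.
    by right=> w w'; rewrite !prefE ltr_pM2l // ltr_nM2l.
  - have {}pm : (pre m < 0)%R by rewrite lt_neqAle ne0.
    by right=> w w'; rewrite !prefE ltr_nM2l // ltr_pM2l.
  - have {}pm : (pre m < 0)%R by rewrite lt_neqAle ne0.
    have {}p0 : (pre i0 < 0)%R by rewrite lt_neqAle ne0.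
    by left=> w w'; rewrite !prefE !ltr_nM2l.
- rewrite s !permK; suff -> : l m i0 == l i0 i0 by [].
  apply/negPn/negP => ne.
  have : i0 < (l i0)^-1 (l m i0).
    by apply: i0_lt; apply: contra_neq ne => /(congr1 (l i0)); rewrite permKV.
  by rewrite -{1}(permK (l i0) i0) -s permK i0_min.
(* Reversed lists with a common first choice have only one entry, contrary to [x != y]. *)
- rewrite s !permK; suff -> : (l m i0 == l i0 i0) = false by [].
  apply/eqP => E.
  have all0 z : z = i0.
    apply/eqP/negPn/negP => /i0_lt; rewrite -{1}(permK (l i0) i0) -(permK (l i0) z).
    by rewrite -s -E permK i0_min.
  by rewrite (all0 x) (all0 y) eqxx in xy.
Qed.

Section Ranked.

Variables (I : sm_instance) (i0 : 'I_(sm_size I)).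
Let sigma := wlist i0.
Let tau := mlist i0.

Definition man_type (i : 'I_(sm_size I)) : bool := mlist (sigma i) i0 == mlist i0 i0.
Definition woman_type (j : 'I_(sm_size I)) : bool := wlist (tau j) i0 == wlist i0 i0.

Lemma num_stable_ranked (R : realType) :
  i0 = 0 :> nat -> one_attribute R I ->
  num_stable I = #|[set pi | tstable man_type woman_type pi]|.
Proof.
move=> i00 [mpre [mpos [wpre [wpos [injm injw prefm prefw]]]]].
have mB i x y : mprefers (sigma i) (tau x) (tau y) = better (man_type i) x y.
  exact: one_attribute_better i00 injm prefm.
have wB j x y : wprefers (tau j) (sigma x) (sigma y) = better (woman_type j) x y.
  exact: one_attribute_better i00 injw prefw.
(* Products apply the left factor first: from a man to his rank, to the rank of his wife, to her
   name. *)
pose f (pi : 'S_(sm_size I)) : 'S_(sm_size I) := (sigma^-1 * pi * tau)%g.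
have fE pi i : f pi (sigma i) = tau (pi i) by rewrite /f !permM permK.
have fV pi j : (f pi)^-1 (tau j) = sigma (pi^-1 j).
  by apply: (perm_inj (s := f pi)); rewrite permKV fE permKV.
have stf pi : stable (f pi) = tstable man_type woman_type pi.
  apply/forallP/forallP => H.
    move=> i; apply/forallP => j.
    have /forallP/(_ (tau j)) := H (sigma i).
    rewrite /blocking fE fV mB wB (inj_eq perm_inj).
    by have [->|] := eqVneq (pi i) j; rewrite ?better_irr.
  move=> m; apply/forallP => w; rewrite -(permKV sigma m) -(permKV tau w).
  rewrite /blocking fE fV mB wB negb_and; apply/orP; right.
  by have /forallP := H (sigma^-1 m).
have f_inj : injective f by move=> p p' /mulIg/mulgI.
rewrite /num_stable -[RHS](card_imset _ f_inj).
congr #|pred_of_set _|; apply/setP => mu; apply/idP/imsetP.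
  rewrite inE => st; exists (sigma * mu * tau^-1)%g.
    by rewrite inE -stf /f mulgA mulKg mulgKV.
  by rewrite /f mulgA mulKg mulgKV.
by case=> pi + ->; rewrite !inE stf.
Qed.

End Ranked.

(** Addresses start at 1, which holds [n]; the men's lists begin at [2] and the women's at
    [2 + n * n], each list taking [n] cells. The inner [inp] finds the person of a given rank, the
    outer one that person's first choice. *)
Lemma num_stable_typed (R : realType) (I : sm_instance) (inp : nat -> nat) :
  let n := sm_size I in
  one_attribute R I ->
  (forall i, i < size (encode_sm I) -> inp i.+1 = nth 0 (encode_sm I) i) ->
  exists mt wt : 'I_n -> bool,
    [/\ num_stable I = #|[set pi | tstable mt wt pi]|,
        forall i, mt i = (inp (2 + n * inp (2 + n * n + i)) == inp 2) &
        forall j, wt j = (inp (2 + n * n + n * inp (2 + j)) == inp (2 + n * n))].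
Proof.
move=> n oneI; rewrite size_encode_sm => inpE.
have mlt (m k : 'I_n) : n * m + k < n * n.
  by have := ltn_ord m; have := ltn_ord k; nia.
have inpm (m k : 'I_n) : inp (2 + n * m + k) = mlist m k.
  by rewrite -nth_encode_mlist -inpE mulnC // -/n; have := mlt m k; lia.
have inpw (w k : 'I_n) : inp (2 + n * n + n * w + k) = wlist w k.
  rewrite -nth_encode_wlist -inpE; first by rewrite -/n; congr inp; lia.
  by rewrite -/n; have := mlt w k; lia.
(* Without persons there is no [i0] to rank by, but both conditions hold vacuously. *)
have [n0|n0] := posnP n.
  have noI (i : 'I_n) : False by case: i => i; rewrite n0.
  exists (fun=> true), (fun=> true); split=> [|i|j]; [|by case: noI..].
  congr #|pred_of_set _|; apply/setP => pi; rewrite !inE.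
  by apply/forallP/forallP => _ i; case: (noI i).
pose i0 : 'I_n := Ordinal n0.
exists (man_type i0), (woman_type i0); split=> [|i|j].
- exact: (num_stable_ranked (R := R)).
- rewrite /man_type -val_eqE /= -!inpm /= !addn0 muln0 addn0.
  by rewrite -inpw /= muln0 addn0.
- rewrite /woman_type -val_eqE /= -!inpw /= !addn0 muln0 addn0.
  by rewrite -inpm /= muln0 addn0.
Qed.

(** * The counting expression *)

(** Truth values are 0 and 1; by truncation a double [notE] turns any positive number into 1. *)
Definition notE a := ESub (ECst 1) a.
Definition andE a b := notE (EAdd (notE a) (notE b)).
Definition orE a b := notE (notE (EAdd a b)).
Definition eqE a b := notE (EAdd (ESub a b) (ESub b a)).
Definition ltE x y := notE (notE (ESub (EVar y) (EVar x))).
Definition allE x a := notE (ESum x (notE a)).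
Definition exE x a := notE (notE (ESum x a)).

(* Bound variables: 3 and 4 are the ends of a mixed pattern, 5 to 8 two couples,
   9 a counter, 12 counts the men in the sorted pattern, and those from 20 on
   serve to multiply by the number of men. *)
Definition wlistsE x := EAdd (ECst 2) (ESum x (ESum x.+1 (ECst 1))).

Definition man_typeE y :=
  eqE (EInp (EAdd (ECst 2) (ESum 20 (EInp (EAdd (wlistsE 21) (EVar y))))))
      (EInp (ECst 2)).

Definition woman_typeE y :=
  eqE (EInp (EAdd (wlistsE 20) (ESum 20 (EInp (EAdd (ECst 2) (EVar y))))))
      (EInp (wlistsE 20)).

Definition betterE b x y := orE (andE b (ltE x y)) (andE (notE b) (ltE y x)).

Definition pairsE (g : nat -> expr) i j :=
  andE (eqE (g j) (man_typeE i))
    (eqE (ESum 9 (andE (betterE (woman_typeE j) 9 i) (eqE (man_typeE 9) (man_typeE i))))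
       (ESum 9 (andE (betterE (man_typeE i) 9 j)
          (andE (eqE (g 9) (g j)) (eqE (woman_typeE 9) (woman_typeE j)))))).

Definition conflictE i j i' j' :=
  orE (notE (eqE (eqE (EVar i) (EVar i')) (eqE (EVar j) (EVar j'))))
    (andE (betterE (man_typeE i) j' j) (betterE (woman_typeE j') i i')).

Definition realizableE (g : nat -> expr) :=
  andE (allE 5 (exE 6 (pairsE g 6 5)))
    (allE 5 (allE 6 (allE 7 (allE 8
      (notE (andE (pairsE g 5 6) (andE (pairsE g 7 8) (conflictE 5 6 7 8)))))))).

Definition sortedE y := notE (notE (ESub (ESum 12 (man_typeE 12)) (EVar y))).

Definition mixedE y :=
  orE (ltE y 3) (andE (notE (ltE 4 y)) (notE (eqE (woman_typeE y) (woman_typeE 3)))).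

Definition countE :=
  EAdd (realizableE sortedE)
    (ESum 3 (ESum 4 (andE (andE (ltE 3 4) (notE (eqE (woman_typeE 3) (woman_typeE 4))))
                        (realizableE mixedE)))).

(** * Correctness of the counting expression *)

Section Eval.

Variables (n : nat) (inp : nat -> nat) (mt wt : 'I_n -> bool).
Hypothesis mtP : forall i : 'I_n, mt i = (inp (2 + n * inp (2 + n * n + i)) == inp 2).
Hypothesis wtP : forall j : 'I_n,
  wt j = (inp (2 + n * n + n * inp (2 + j)) == inp (2 + n * n)).

Local Notation ev := (eval n inp).
Implicit Types (rho : nat -> nat) (e : expr) (i j : 'I_n).

Lemma eval_not rho e (b : bool) : ev rho e = b -> ev rho (notE e) = ~~ b.
Proof. by move=> /= ->; case: b. Qed.

Lemma eval_and rho e e' (b b' : bool) :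
  ev rho e = b -> ev rho e' = b' -> ev rho (andE e e') = b && b'.
Proof. by move=> /= -> ->; case: b; case: b'. Qed.

Lemma eval_or rho e e' (b b' : bool) :
  ev rho e = b -> ev rho e' = b' -> ev rho (orE e e') = b || b'.
Proof. by move=> /= -> ->; case: b; case: b'. Qed.

Lemma eval_eq rho e e' : ev rho (eqE e e') = (ev rho e == ev rho e').
Proof. by rewrite /=; case: eqP; lia. Qed.

Lemma eval_eqb rho e e' (b b' : bool) :
  ev rho e = b -> ev rho e' = b' -> ev rho (eqE e e') = (b == b').
Proof. by rewrite eval_eq => -> ->; case: b; case: b'. Qed.

Lemma eval_lt rho x y : ev rho (ltE x y) = (rho x < rho y).
Proof. by rewrite /=; case: ltnP; lia. Qed.

Lemma eval_card rho x e (p : 'I_n -> bool) :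
  (forall i, ev (upd rho x i) e = p i) -> ev rho (ESum x e) = #|[set i | p i]|.
Proof.
move=> pP /=; rewrite -sum1dep_card [RHS]big_mkcond; apply: eq_bigr => i _.
by rewrite pP; case: (p i).
Qed.

Lemma eval_all rho x e (p : 'I_n -> bool) :
  (forall i, ev (upd rho x i) e = p i) -> ev rho (allE x e) = [forall i, p i].
Proof.
move=> pP; rewrite /allE; have /= -> := @eval_card rho x (notE e) (fun i => ~~ p i).
  have -> : [forall i, p i] = (#|[set i | ~~ p i]| == 0).
    rewrite cards_eq0; apply/forallP/eqP => [pi|p0 i].
      by apply/setP => i; rewrite !inE pi.
    by apply/negPn/negP => npi; have := in_set0 i; rewrite -p0 inE npi.
  by case: #|_|.
by move=> i; apply: eval_not.
Qed.

Lemma eval_ex rho x e (p : 'I_n -> bool) :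
  (forall i, ev (upd rho x i) e = p i) -> ev rho (exE x e) = [exists i, p i].
Proof.
move=> pP; rewrite /exE /notE; have := eval_card pP => /= ->.
have -> : [exists i, p i] = (0 < #|[set i | p i]|).
  rewrite card_gt0; apply/existsP/set0Pn => -[i pi]; exists i; move: pi; rewrite inE //.
by case: #|_|.
Qed.

Lemma eval_sum rho x e (F : 'I_n -> nat) :
  (forall i, ev (upd rho x i) e = F i) -> ev rho (ESum x e) = \sum_i F i.
Proof. by move=> eF /=; apply: eq_bigr. Qed.

Lemma eval_mul rho x e c : (forall i : 'I_n, ev (upd rho x i) e = c) ->
  ev rho (ESum x e) = n * c.
Proof.
by move=> /eval_sum ->; rewrite sum_nat_const card_ord.
Qed.

Lemma eval_add rho e e' : ev rho (EAdd e e') = ev rho e + ev rho e'.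
Proof. by []. Qed.

Lemma eval_inp rho e : ev rho (EInp e) = inp (ev rho e).
Proof. by []. Qed.

Lemma eval_wlists rho x : ev rho (wlistsE x) = 2 + n * n.
Proof.
rewrite eval_add; congr addn; apply: eval_mul => i.
by rewrite (@eval_mul _ _ _ 1) ?muln1.
Qed.

Lemma eval_man_type rho y i : y < 20 -> rho y = i -> ev rho (man_typeE y) = mt i.
Proof.
move=> y20 yi; rewrite /man_typeE eval_eq mtP 2!eval_inp eval_add.
congr (nat_of_bool (inp (_ + _) == _)); apply: eval_mul => k.
by rewrite eval_inp eval_add eval_wlists /= updE ltn_eqF // yi.
Qed.

Lemma eval_woman_type rho y j : y < 20 -> rho y = j -> ev rho (woman_typeE y) = wt j.
Proof.
move=> y20 yj; rewrite /woman_typeE eval_eq wtP 2!eval_inp eval_add !eval_wlists.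
congr (nat_of_bool (inp (_ + _) == _)); apply: eval_mul => k.
by rewrite eval_inp eval_add /= updE ltn_eqF // yj.
Qed.

Lemma eval_better rho e (b : bool) x y i j : ev rho e = b -> rho x = i -> rho y = j ->
  ev rho (betterE e x y) = better b i j.
Proof.
move=> eb xi yj; rewrite /betterE.
rewrite (eval_or (eval_and eb (eval_lt _ _ _)) (eval_and (eval_not eb) (eval_lt _ _ _))).
by rewrite xi yj /better; case: (b); rewrite ?orbF.
Qed.

(** A pattern expression is evaluated under further bound variables, so only the ends 3 and 4 are
    fixed; [y < 12] avoids capture by the variable bound in [sortedE]. *)
Definition represents rho (gE : nat -> expr) (g : 'I_n -> bool) : Prop :=
  forall rho' y j, rho' 3 = rho 3 -> rho' 4 = rho 4 -> y < 12 -> rho' y = j ->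
    ev rho' (gE y) = g j.

Lemma represents_upd rho gE g x v :
  4 < x -> represents rho gE g -> represents (upd rho x v) gE g.
Proof. by move=> x4 gP rho' y j r3 r4; apply: gP; rewrite ?r3 ?r4 updE; case: eqP; lia. Qed.

Lemma eval_pairs rho gE (g : {ffun 'I_n -> bool}) x y i j :
  represents rho gE g -> 4 < x < 9 -> 4 < y < 9 -> rho x = i -> rho y = j ->
  ev rho (pairsE gE x y) = pairs mt wt g i j.
Proof.
move=> gP x9 y9 xi yj; rewrite /pairsE; apply: eval_and.
  by apply: eval_eqb; [apply: gP => //; lia|apply: eval_man_type => //; lia].
rewrite eval_eq; congr (nat_of_bool (_ == _)); apply: eval_card => k.
  all: have kx : upd rho 9 k x = i by rewrite updE; case: eqP => //; lia.
  all: have ky : upd rho 9 k y = j by rewrite updE; case: eqP => //; lia.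
  all: have kk : upd rho 9 k 9 = k by [].
  apply: eval_and; first by apply: eval_better => //; apply: eval_woman_type => //; lia.
  by apply: eval_eqb; apply: eval_man_type => //; lia.
have gP' := @represents_upd _ _ _ 9 k isT gP.
apply: eval_and; first by apply: eval_better => //; apply: eval_man_type => //; lia.
apply: eval_and; first by apply: eval_eqb; apply: gP' => //; lia.
by apply: eval_eqb; apply: eval_woman_type => //; lia.
Qed.

Lemma eval_conflict rho i j i' j' :
  rho 5 = i -> rho 6 = j -> rho 7 = i' -> rho 8 = j' ->
  ev rho (conflictE 5 6 7 8) = conflict mt wt i j i' j'.
Proof.
move=> e5 e6 e7 e8; apply: eval_or.
  by apply: eval_not; apply: eval_eqb; rewrite eval_eq /= ?e5 ?e6 ?e7 ?e8.
by apply: eval_and; apply: eval_better => //;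
  [apply: eval_man_type|apply: eval_woman_type].
Qed.

Lemma eval_realizable rho gE (g : {ffun 'I_n -> bool}) :
  represents rho gE g -> ev rho (realizableE gE) = realizable mt wt g.
Proof.
move=> gP; apply: eval_and.
  apply: eval_all => j; apply: eval_ex => i; apply: eval_pairs => //.
apply: eval_all => i; apply: eval_all => j; apply: eval_all => i'.
apply: eval_all => j'; apply: eval_not.
have gP' : represents (upd (upd (upd (upd rho 5 i) 6 j) 7 i') 8 j') gE g.
  exact: gP.
apply: eval_and; first exact: eval_pairs.
by apply: eval_and; [apply: eval_pairs|apply: eval_conflict].
Qed.

Lemma represents_sorted rho : represents rho sortedE (sorted_pattern mt).
Proof.
move=> rho' y j _ _ y12 yj; rewrite ffunE /sortedE /notE.
have /= -> : ev rho' (ESum 12 (man_typeE 12)) = #|[set i | mt i]|.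
  by apply: eval_card => i; apply: eval_man_type.
by rewrite yj; case: ltnP; lia.
Qed.

Lemma represents_mixed rho (p q : 'I_n) : rho 3 = p -> rho 4 = q ->
  represents rho mixedE (mixed_pattern wt p q).
Proof.
move=> r3 r4 rho' y j e3 e4 y12 yj; rewrite ffunE; rewrite r3 in e3; rewrite r4 in e4.
apply: eval_or; first by rewrite eval_lt yj e3.
apply: eval_and.
  by rewrite (eval_not (eval_lt _ _ _)) yj e4 -leqNgt.
by apply: eval_not; apply: eval_eqb; apply: eval_woman_type => //; lia.
Qed.

Lemma eval_count rho : ev rho countE = #|[set pi | tstable mt wt pi]|.
Proof.
rewrite card_tstable_patterns eval_add; congr addn.
  by apply: eval_realizable; apply: represents_sorted.
apply: eval_sum => p; apply: eval_sum => q; apply: eval_and; last first.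
  by apply: eval_realizable; apply: represents_mixed.
apply: eval_and; first exact: eval_lt.
by apply: eval_not; apply: eval_eqb; apply: eval_woman_type.
Qed.

End Eval.

(** * The complete program *)

Definition program_of e : program :=
  relocate ++ compile (size relocate) 23 e ++ [:: IConst 1 0; IAdd 0 23 1].

(** Variables lie below register 23 and temporaries from 23 up to 199. The result appears in
    register 23, from where the last two instructions move it to register 0. *)
Lemma program_of_correct e input :
  scoped 23 [::] 3 e -> 23 + height e <= 200 -> 0 < size input ->
  exists t X inp rho,
    [/\ t <= 2000 * size input + (time (nth 0 input 0) e + 2),
        reaches (program_of e) t (initial input) (Config (size (program_of e)) X),
        X 0 = eval (nth 0 input 0) inp rho e &
        forall i, i < size input -> inp i.+1 = nth 0 input i].
Proof.
move=> sc hM sz; set n := nth 0 input 0.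
have at0 : code_at (program_of e) 0 (program_of e).
  by exists [::] => //; exists [::]; rewrite cats0.
have [cR /code_at_cat[cC /code_at_cons[s1 /code_at_cons[s2 _]]]] := code_at_cat at0.
have [t [X [tle rX X0 X1 [X2 Xi]]]] := relocate_correct cR sz.
set B := _.-1 in X0 Xi.
pose inp i := X (X 0 + i).
(* Eight doublings make [B] at least 255, so the copy of the input lies above the temporaries. *)
have eX : env_ok 200 n inp X by split=> //; rewrite X0 /B; lia.
have [|||X' [rX' X'h fX']] := compile_correct (p := size relocate) cC sc _ _ _ hM eX; try by [].
have X'1 : X' 1 = 1 by rewrite fX'.
exists (t + (time n e + 2)), (upd (upd X' 1 0) 0 (X' 23)), inp, X; split.
- by rewrite leq_add2r.
- apply: (reaches_trans rX); apply: (reaches_trans rX').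
  apply: reaches_step; rewrite s1 /=; apply: reaches_step; rewrite s2 /=.
  rewrite /reaches /= updE /= addn0; congr Config.
  by rewrite /program_of !size_cat /=; lia.
- by rewrite updE /= X'h.
by move=> i iL; rewrite /inp X0 Xi.
Qed.

Theorem theorem2 (R : realType) :
  polytime_on encode_sm (one_attribute R) num_stable.
Proof.
have [c [d timeP]] := poly_bounded_time countE.
apply: (@polytime_on_steps _ _ _ _ (program_of countE)
  (fun S => 2000 * S + (c * S.+1 ^ d + 2))).
- apply: poly_boundedD.
    by apply: poly_boundedM; [apply: poly_bounded_const|apply: poly_bounded_id].
  by apply: poly_boundedD; [exists c, d|apply: poly_bounded_const].
- by move=> I _; rewrite size_encode_sm.
move=> I oneI; set input := encode_sm I; set n := sm_size I.
have szE : size input = (n * n + n * n).+1 by rewrite size_encode_sm.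
have sz : 0 < size input by rewrite szE.
have sc : scoped 23 [::] 3 countE by vm_compute.
have hM : 23 + height countE <= 200 by vm_compute.
have [t [X [inp [rho [tle rX X0 inpE]]]]] := program_of_correct sc hM sz.
exists t, X; split; [|exact: rX|]; clear rX.
  apply: leq_trans tle _; apply: leq_add.
    by rewrite leq_mul2l size_input_length orbT.
  rewrite leq_add2r; apply: leq_trans (timeP _) _; rewrite leq_mul2l; apply/orP; right.
  (* The running time is polynomial in [n], and [n] is at most the number of input entries,
     [n * n + n * n + 1]. *)
  apply: leq_exp_base; rewrite ltnS.
  by apply: leq_trans (size_input_length _); rewrite szE /= -/n; nia.
have [mt [wt [-> mtP wtP]]] := num_stable_typed oneI inpE.
by rewrite X0; apply: eval_count.
Qed.
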